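(* Let $p$ be an odd prime and let $f:\mathbb{F}_{p^{2k}}\to\mathbb{F}_p$ satisfy Condition A with sign $\epsilon$. Let $D_{\mathcal S}=\{x\in\mathbb{F}_{p^{2k}}^*: f(x)\text{ is a nonzero square in }\mathbb{F}_p\}$. Then $D_{\mathcal S}$ is a $(v,d,\lambda_1,\lambda_2)$ partial difference set in the additive group of $\mathbb{F}_{p^{2k}}$, where $v=p^{2k}$, $d=\frac12(p^k-p^{k-1})(p^k-\epsilon)$, $\lambda_1=\frac14(p^k-p^{k-1})^2-\frac{3\epsilon}{2}(p^k-p^{k-1})+\epsilon p^k$, $\lambda_2=\frac12(p^k-p^{k-1})\left(\frac12(p^k-p^{k-1})-\epsilon\right)$. Consequently the Cayley graph on $\mathbb{F}_{p^{2k}}$ generated by $D_{\mathcal S}$ is strongly regular with these parameters.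
   Context: Let $\zeta_p$ be a primitive complex $p$-th root of unity and $\mathrm{tr}$ the absolute trace from $\mathbb{F}_{p^{2k}}$ to $\mathbb{F}_p$. For $f:\mathbb{F}_{p^{2k}}\to\mathbb{F}_p$ the Walsh transform is $\mathcal{W}_f(b)=\sum_{x\in\mathbb{F}_{p^{2k}}}\zeta_p^{f(x)+\mathrm{tr}(bx)}$. Condition A: $p$ is an odd prime and $f:\mathbb{F}_{p^{2k}}\to\mathbb{F}_p$ satisfies $f(0)=0$, $f(-x)=f(x)$ for all $x$; there is an integer $l$ with $\gcd(l-1,p-1)=1$ such that $f(\alpha x)=\alpha^l f(x)$ for all $\alpha\in\mathbb{F}_p$, $x\in\mathbb{F}_{p^{2k}}$; and there exist a constant $\epsilon\in\{1,-1\}$ and a function $f^*:\mathbb{F}_{p^{2k}}\to\mathbb{F}_p$ such that $\mathcal{W}_f(b)=\epsilon p^k\zeta_p^{f^*(b)}$ for all $b\in\mathbb{F}_{p^{2k}}$. A $d$-subset $D$ of a finite abelian group $G$ (written additively, of order $v$) with $0\notin D$ is a $(v,d,\lambda,\mu)$ partial difference set if every nonzero element of $D$ can be written as $g-h$ with $g,h\in D$ in exactly $\lambda$ ways, and every nonzero element of $G\setminus D$ can be written so in exactly $\mu$ ways. The Cayley graph generated by a symmetric $D$ has vertex set $G$, with $x\sim y$ iff $x-y\in D$. *)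

(* Defs.v *)
From HB Require Import structures.
From mathcomp Require Import all_boot all_order all_algebra all_fingroup all_field.
Set Implicit Arguments. Unset Strict Implicit. Unset Printing Implicit Defensive.
Import Order.TTheory GRing.Theory Num.Theory.
Local Open Scope ring_scope.

(* The element of 'F_p whose image in F (characteristic p) is y; 0 if none. *)
Definition Fp_of (p : nat) (F : finFieldType) (y : F) : 'F_p :=
  odflt 0 [pick a : 'F_p | ((a : nat)%:R : F) == y].

Definition abs_tr (p k : nat) (F : finFieldType) (x : F) : 'F_p :=
  Fp_of p (\sum_(i < 2 * k) x ^+ (p ^ i)).

Definition fpscale (p : nat) (F : finFieldType) (a : 'F_p) (x : F) : F :=
  ((a : nat)%:R : F) * x.

Definition walsh (p k : nat) (F : finFieldType) (zeta : algC)
    (f : F -> 'F_p) (b : F) : algC :=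
  \sum_(x : F) zeta ^+ (nat_of_ord (f x + abs_tr p k (b * x))).

(* Condition A (p odd prime, #|F| = p^(2k) are separate hypotheses) *)
Definition conditionA (p k : nat) (F : finFieldType) (zeta : algC)
    (f : F -> 'F_p) (eps : int) : Prop :=
  [/\ f 0 = 0,
      (forall x, f (- x) = f x),
      (exists l : int, gcdz (l - 1) (p%:Z - 1) = 1 /\
          forall (a : 'F_p) (x : F), f (fpscale a x) = a ^ l * f x),
      (eps = 1 \/ eps = -1) &
      exists fstar : F -> 'F_p, forall b : F,
        walsh k zeta f b = eps%:~R * (p ^ k)%:R * zeta ^+ (nat_of_ord (fstar b))].

Definition is_pds (G : finZmodType) (D : {set G}) (v d lam mu : nat) : Prop :=
  [/\ #|G| = v, #|D| = d, 0 \notin D &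
      forall x : G, x != 0 ->
        #|[set gh in setX D D | gh.1 - gh.2 == x]| = if x \in D then lam else mu].

Definition cayley (G : finZmodType) (D : {set G}) : rel G :=
  fun x y => (x - y) \in D.

Definition is_srg (T : finType) (e : rel T) (v d lam mu : nat) : Prop :=
  [/\ #|T| = v, irreflexive e, symmetric e,
      (forall x, #|[set y | e x y]| = d) &
      forall x y, x != y ->
        #|[set z | e x z && e y z]| = if e x y then lam else mu].

(* Main.v *)
Require Import Defs.
From HB Require Import structures.
From mathcomp Require Import all_boot all_order all_algebra all_fingroup all_field.
From mathcomp Require Import ring zify.
Import Order.TTheory GRing.Theory Num.Theory.
Local Open Scope ring_scope.
Set Implicit Arguments. Unset Strict Implicit. Unset Printing Implicit Defensive.

(* Write e(a) = zeta^a and let S be the set of nonzero squares of 'F_p.  By Fourier inversion on 'F_p,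
   the indicator of S is (1/p) sum_t eta(-t) e(t i), where eta(t) = sum_(s in S) e(t s), so the Fourier
   transform at b of D = {x | f x in S} is a combination of the sums V_t = sum_x e(t f(x) + tr(b x)).
   For t = u^(1-l), u <> 0, the substitution x = u y turns V_t into the conjugate of W_f(b) under
   zeta |-> zeta^u, that is eps p^k e(u f*(b)).  As u |-> u^(1-l) permutes 'F_p^* and preserves
   quadratic character (l is even), a second inversion on 'F_p gives, for b <> 0,
   p D^(b) = eps p^k (p [f*(b) in S] - |S|), which takes only two values.  A symmetric set whose
   nontrivial Fourier coefficients take two values is a partial difference set.  The value at b = 0
   needs f*(0) = 0: otherwise p |f^-1(0)| = p^(2k) - eps p^k would be even, while |f^-1(0)| is odd
   because f is even and f(0) = 0. *)

(** * Cayley graphs of symmetric partial difference sets *)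

Lemma is_pds_srg (G : finZmodType) (D : {set G}) (v d lam mu : nat) :
  (forall x, (- x \in D) = (x \in D)) ->
  is_pds D v d lam mu -> is_srg (cayley D) v d lam mu.
Proof.
move=> DN [cG cD D0 pdsD]; split=> //.
- by move=> x; rewrite /cayley subrr (negbTE D0).
- by move=> x y; rewrite /cayley -DN opprB.
- move=> x; rewrite -cD -(card_imset (mem D) (@subrI G x)); apply: eq_card => y.
  rewrite inE /cayley; apply/idP/imsetP => [xyD | [g gD ->]].
    by exists (x - y) => //; rewrite subKr.
  by rewrite subKr.
move=> x y xDy; rewrite -pdsD ?subr_eq0 //.
(* A common neighbour [z] of [x] and [y] corresponds to the pair [(x - z, y - z)] of elements of
   [D], whose difference is [x - y]. *)
have inj_h : injective (fun z : G => (x - z, y - z)).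
  by move=> z1 z2 [/subrI].
rewrite -(card_imset _ inj_h); apply: eq_card => -[g h].
rewrite !inE /=; apply/imsetP/andP => [[z] | [/andP[gD hD] /eqP ghE]].
  by rewrite inE /cayley => /andP[xzD yzD] [-> ->]; rewrite xzD yzD opprB addrA subrK.
have yE : y - (x - g) = h by rewrite opprB addrCA -opprB -ghE opprB addrC subrK.
by exists (x - g); rewrite ?inE /cayley subKr yE ?gD.
Qed.

(** * Fourier analysis on the additive group of a finite field *)

Section Fourier.
Variables (F : finFieldType) (chi : F -> algC).
Hypothesis chiD : {morph chi : x y / x + y >-> x * y}.
Hypothesis chi0 : chi 0 = 1.
Hypothesis chi_nontriv : exists x, chi x != 1.

(** For [c != 0], translating [b] by [y / c] multiplies the sum by [chi y]; choosing [y] with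
    [chi y != 1] forces it to vanish. *)
Lemma sum_add_char (c : F) :
  \sum_b chi (b * c) = if c == 0 then #|F|%:R else 0.
Proof.
case: eqP => [-> | /eqP c0].
  by rewrite (eq_bigr (fun=> 1)) ?sumr_const// => b _; rewrite mulr0 chi0.
have [y chiy] := chi_nontriv; set S := \sum_b _.
have : S = chi y * S.
  rewrite /S [LHS](reindex_inj (addrI (y / c))) /= mulr_sumr.
  by apply: eq_bigr => b _; rewrite mulrDl divfK// chiD.
move/eqP; rewrite -subr_eq0 -{1}[S]mul1r -mulrBl mulf_eq0 subr_eq0 eq_sym.
by rewrite (negbTE chiy) => /eqP.
Qed.

Variable D : {set F}.
Hypothesis DN : forall x, (- x \in D) = (x \in D).
Let hat b := \sum_(g in D) chi (b * g).

Lemma fourier_inversion x :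
  \sum_b hat b * chi (b * - x) = #|F|%:R * (x \in D)%:R.
Proof.
under eq_bigr do rewrite mulr_suml.
rewrite exchange_big /= (eq_bigr (fun g => #|F|%:R * (g == x)%:R)).
  rewrite -mulr_sumr; congr (_ * _); case: (boolP (x \in D)) => xD.
    by rewrite (bigD1 x)//= eqxx big1 ?addr0// => g /andP[_ /negbTE->].
  by rewrite big1// => g gD; case: eqP gD xD => // -> ->.
move=> g gD; under eq_bigr do rewrite -chiD -mulrDr.
by rewrite sum_add_char subr_eq0; case: eqP; rewrite ?mulr1 ?mulr0.
Qed.

(** As [D] is symmetric, one factor of [hat b ^+ 2] may be summed over [- g], so the square is the
    transform of the multiset of differences of [D]. *)
Lemma fourier_inversion_sqr x :
  \sum_b hat b ^+ 2 * chi (b * - x) =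
  #|F|%:R * #|[set gh in setX D D | gh.1 - gh.2 == x]|%:R.
Proof.
have hatN b : hat b = \sum_(g in D) chi (b * - g).
  rewrite /hat (reindex_inj (@oppr_inj F)) /=.
  by apply: eq_bigl => g; rewrite DN.
have hat2 b : hat b ^+ 2 = \sum_(gh in setX D D) chi (b * (gh.1 - gh.2)).
  rewrite expr2 {2}hatN mulr_suml; under eq_bigr do rewrite mulr_sumr.
  rewrite pair_big_dep /=; apply: eq_big => [[g h]|[g h] _] /=.
    by rewrite inE.
  by rewrite -chiD -mulrDr.
under eq_bigr do rewrite hat2 mulr_suml.
rewrite exchange_big /=.
rewrite (eq_bigr (fun gh => #|F|%:R * (gh.1 - gh.2 == x)%:R)).
  rewrite -mulr_sumr; congr (_ * _).
  rewrite -sum1_card natr_sum big_mkcond [RHS]big_mkcond /=.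
  apply: eq_bigr => gh _.
  by rewrite [in RHS]inE; do 2!case: ifP => //=; case: eqP.
move=> gh _; under eq_bigr do rewrite -chiD -mulrDr.
by rewrite sum_add_char subr_eq0; case: eqP; rewrite ?mulr1 ?mulr0.
Qed.

(* Off b = 0 the transform satisfies hat^2 = (r + s) hat - r s; inverting
   this quadratic relation gives the count. *)
Lemma two_valued_transform_count (r s : algC) x :
  (forall b, b != 0 -> hat b = r \/ hat b = s) -> x != 0 ->
  #|F|%:R * #|[set gh in setX D D | gh.1 - gh.2 == x]|%:R =
  (r + s) * (#|F|%:R * (x \in D)%:R) + (#|D|%:R - r) * (#|D|%:R - s).
Proof.
move=> hat_rs x0; rewrite -fourier_inversion_sqr -fourier_inversion.
(* Since [hat 0 = #|D|], the last summand corrects the quadratic relation at [b = 0]. Under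
   inversion the constant [r * s] contributes 0 because [x != 0]. *)
have hatE b : hat b ^+ 2 = (r + s) * hat b - r * s
    + (b == 0)%:R * ((#|D|%:R - r) * (#|D|%:R - s)).
  have [-> | /hat_rs[]->] := eqVneq b 0; rewrite /=; [| ring | ring].
  rewrite /hat (eq_bigr (fun=> 1)) ?sumr_const /=; first by ring.
  by move=> g _; rewrite mul0r chi0.
under eq_bigr do rewrite hatE mulrDl mulrDl -mulrA.
rewrite !big_split /= -!mulr_sumr sum_add_char oppr_eq0 (negbTE x0) mulr0 addr0.
congr (_ + _); rewrite (bigD1 0)//= big1 => [|b /negbTE->]; last by rewrite !mul0r.
by rewrite eqxx mul0r chi0 addr0 mulr1 mul1r.
Qed.

End Fourier.

(** * Parity of symmetric sets in odd characteristic *)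

Lemma two_neq0_odd_pchar (R : nzRingType) p :
  odd p -> p \in [pchar R] -> (2%:R : R) != 0.
Proof.
move=> p_odd pR; rewrite -(dvdn_pcharf pR); apply/negP => /dvdn_leq -/(_ isT).
by have := prime_gt1 (pcharf_prime pR); case: p p_odd {pR} => [|[|[|]]].
Qed.

(* Off 0 the points of A pair up as {x, -x}. *)
Lemma odd_card_symmetric (F : finFieldType) (A : {set F}) :
  (2%:R : F) != 0 -> (forall x, (- x \in A) = (x \in A)) -> odd #|A| = (0 \in A).
Proof.
move=> two0; have [n] := ubnP #|A|; elim: n A => // n IHn A leAn AN.
have [A0 | [x xA x0]] : A \subset [set 0] \/ exists2 x, x \in A & x != 0.
- have [|/subsetPn[x xA]] := boolP (A \subset [set 0]); first by left.
  by rewrite inE; right; exists x.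
- by move: A0; rewrite subset1 => /orP[]/eqP->; rewrite ?cards1 ?cards0 inE ?eqxx.
have xNx : x != - x by rewrite -addr_eq0 -mulr2n -mulr_natl mulf_neq0.
have cA : #|A| = #|A :\: [set x; - x]|.+2.
  rewrite -(cardsID [set x; - x] A) (_ : A :&: _ = [set x; - x]) ?cards2 ?xNx//.
  by apply/setIidPr; rewrite subUset !sub1set AN xA.
rewrite cA /= negbK IHn; first 1 last.
- by rewrite -ltnS (leq_trans _ leAn) ?cA ?ltnS.
- by move=> y; rewrite !inE AN -[in RHS](inj_eq oppr_inj) eqr_oppLR orbC eqr_opp.
by rewrite !inE ![0 == _]eq_sym oppr_eq0 (negbTE x0).
Qed.

(** * The absolute trace: values in the prime field, linearity, nontriviality *)

Section Trace.
Variables (p k : nat) (F : finFieldType).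
Hypotheses (p_pr : prime p) (k_gt0 : (0 < k)%N) (cF : #|F| = (p ^ (2 * k))%N).
Let iota (a : 'F_p) : F := (a : nat)%:R.

Let pF : p \in [pchar F] := card_finPcharP cF p_pr.

Lemma natr_pchar_modn m : (m %% p)%:R = m%:R :> F.
Proof. by rewrite {2}(divn_eq m p) natrD natrM (pcharf0 pF) mulr0 add0r. Qed.

Lemma natr_Fp_inj : injective iota.
Proof.
suff le (a b : 'F_p) : (a <= b)%N -> iota a = iota b -> a = b.
  move=> a b iab; have [/le->//|/ltnW/le->//] := leqP a b.
move=> leab /esym /eqP; rewrite /iota -subr_eq0 -natrB// -(dvdn_pcharf pF).
have ltb : (b < p)%N by have := ltn_ord b; rewrite {2}Fp_cast.
move=> dv; apply/val_inj/eqP; rewrite eqn_leq leab /=.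
have [/eqP|ba] := posnP (b - a)%N; first by rewrite subn_eq0.
by have := dvdn_leq ba dv; rewrite leqNgt (leq_ltn_trans (leq_subr _ _)).
Qed.

Lemma natr_FpD a b : iota (a + b) = iota a + iota b.
Proof.
by rewrite -[a]natr_Zp -[b]natr_Zp -natrD /iota !val_Fp_nat// !natr_pchar_modn natrD.
Qed.

Lemma natr_Fp_eq0 a : (iota a == 0) = (a == 0).
Proof. by rewrite -[0 in LHS]/(iota 0) (inj_eq natr_Fp_inj). Qed.

(* The p images of 'F_p already exhaust the roots of X^p - X. *)
Lemma Fp_ofK y : y ^+ p = y -> iota (Fp_of p y) = y.
Proof.
move=> yp; rewrite /Fp_of; case: pickP => [a /eqP // | noty].
have P0 : ('X^p - 'X : {poly F}) != 0.
  by rewrite -size_poly_eq0 size_polyDl size_polyXn// size_polyN size_polyX ltnS prime_gt1.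
have := @max_poly_roots _ _ (y :: codom iota) P0.
rewrite size_polyDl size_polyXn ?size_polyN ?size_polyX ?ltnS ?prime_gt1//.
rewrite /= size_codom card_Fp// ltnn => H; suff: false by []; apply: H.
- apply/andP; split; first by rewrite /root !hornerE yp subrr.
  apply/allP => _ /codomP[a ->]; rewrite /root !hornerE.
  by rewrite -(pFrobenius_autE pF) pFrobenius_aut_nat subrr.
rewrite (map_inj_uniq natr_Fp_inj) enum_uniq andbT.
by apply/codomP => -[a ya]; move: (noty a); rewrite ya /iota eqxx.
Qed.

Let T (x : F) := \sum_(i < 2 * k) x ^+ (p ^ i).

(** Frobenius permutes the summands of [T x] cyclically, since [x ^+ (p ^ (2 * k)) = x]. Hence [T x]
    lies in the prime field and the default value in [Fp_of] is never reached. *)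
Lemma natr_abs_tr x : iota (abs_tr p k x) = T x.
Proof.
apply: Fp_ofK; rewrite -(pFrobenius_autE pF) rmorph_sum /=.
have -> : (2 * k)%N = (2 * k).-1.+1 by rewrite prednK// muln_gt0.
rewrite big_ord_recr [RHS]big_ord_recl /= addrC pFrobenius_autE -exprM -expnSr.
rewrite prednK ?muln_gt0// -cF expf_card expr1; congr (_ + _).
by apply: eq_bigr => i _; rewrite pFrobenius_autE -exprM -expnSr.
Qed.

Lemma abs_trD x y : abs_tr p k (x + y : F) = abs_tr p k x + abs_tr p k y.
Proof.
apply: natr_Fp_inj; rewrite natr_FpD !natr_abs_tr -big_split /=.
apply: eq_bigr => i _; rewrite exprDn_pchar// pnatX; apply/orP; left.
by rewrite pnatE.
Qed.

Lemma abs_tr0 : abs_tr p k (0 : F) = 0.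
Proof. by apply: (addrI (abs_tr p k (0 : F))); rewrite -abs_trD !addr0. Qed.

Lemma abs_tr_scale a x : abs_tr p k (iota a * x : F) = a * abs_tr p k x.
Proof.
rewrite -[in RHS](natr_Zp a) /iota !mulr_natl.
elim: (a : nat) => [|m IHm]; first by rewrite !mulr0n abs_tr0.
by rewrite !mulrSr abs_trD IHm.
Qed.

(** The trace is a polynomial of degree [p ^ (2 * k).-1], too small for all [p ^ (2 * k)] elements
    of [F] to be roots. *)
Lemma abs_tr_nontriv : exists x : F, abs_tr p k x != 0.
Proof.
apply/existsP; rewrite -[[exists _, _]]negbK negb_exists; apply/negP => /forallP tr0.
pose P : {poly F} := \sum_(i < 2 * k) 'X^(p ^ i).
have k2 : (2 * k)%N = (2 * k).-1.+1 by rewrite prednK// muln_gt0.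
have szP : size P = (p ^ (2 * k).-1).+1.
  rewrite /P k2 big_ord_recr /= addrC size_polyDl size_polyXn//.
  rewrite ltnS (leq_trans (size_sum _ _ _))//; apply/bigmax_leqP => i _.
  by rewrite size_polyXn ltn_exp2l ?prime_gt1.
have P0 : P != 0 by rewrite -size_poly_eq0 szP.
have := max_poly_roots P0 (rs := enum F).
rewrite szP -cardE cF ltnS leq_exp2l ?prime_gt1// {1}k2 ltnn => H.
suff: false by []; apply: H; last exact: enum_uniq.
apply/allP => x _; rewrite /root /P horner_sum.
under eq_bigr do rewrite hornerXn.
by rewrite -/(T x) -natr_abs_tr (eqP (negPn (tr0 x))).
Qed.

End Trace.

(** * Squares, power maps and additive characters of the prime field *)

Section PrimeField.
Variable p : nat.
Hypotheses (p_pr : prime p) (p_odd : odd p).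

Definition nzsquares : {set 'F_p} :=
  [set i : 'F_p | (i != 0) && [exists b : 'F_p, b ^+ 2 == i]].

(** Squaring is two-to-one on nonzero elements, with fibres [[set c; - c]]. *)
Lemma card_nzsquares : (2 * #|nzsquares| = p.-1)%N.
Proof.
rewrite -[in RHS](card_Fp p_pr) -(cardC1 (0 : 'F_p)) -[RHS]sum1_card.
rewrite (partition_big (fun b : 'F_p => b ^+ 2) (mem nzsquares)) /=; last first.
  by move=> b; rewrite !inE expf_eq0 => ->; apply/existsP; exists b; exact: eqxx.
rewrite mulnC -sum_nat_const; apply: eq_bigr => s.
rewrite inE => /andP[s0 /existsP[c /eqP cs]].
have c0 : c != 0 by move: s0; rewrite -cs expf_eq0.
rewrite sum1_card; transitivity #|[set c; - c]|.
  by rewrite cards2 -addr_eq0 -mulr2n -mulr_natl mulf_neq0 ?(two_neq0_odd_pchar p_odd (pchar_Fp p_pr)).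
apply: eq_card => b; rewrite !inE -[RHS]topredE /= inE -cs eqf_sqr andb_idl//.
by case/orP => /eqP->; rewrite ?oppr_eq0.
Qed.

Lemma expn_nzsquares k : (0 < k)%N ->
  (p ^ k = #|nzsquares| * p ^ k.-1 * 2 + p ^ k.-1)%N.
Proof.
move=> k_gt0; rewrite -[in LHS](prednK k_gt0) expnS -{1}(prednK (prime_gt0 p_pr)).
by rewrite -card_nzsquares mulSn addnC -mulnA mulnC.
Qed.

Lemma nzsquaresM (c i : 'F_p) : c != 0 -> (c ^+ 2 * i \in nzsquares) = (i \in nzsquares).
Proof.
move=> c0; rewrite !inE mulf_eq0 expf_eq0 (negbTE c0) /=; congr (_ && _).
apply/existsP/existsP => -[b /eqP bE].
  by exists (b / c); rewrite exprMn exprVn bE mulrC mulKf// expf_neq0.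
by exists (c * b); rewrite exprMn bE.
Qed.

(** Bezout gives [u * m + v * (p - 1) = 1], so by Fermat the [u]-th power undoes the [m]-th power on
    nonzero elements; [m != 0] ensures [0 ^ m = 0]. *)
Lemma exprz_Fp_inj (m : int) : m != 0 -> gcdz m (p%:Z - 1) = 1 ->
  injective (fun a : 'F_p => a ^ m).
Proof.
move=> m0 gm a b /= ab; have [u [v uv]] := Bezoutz m (p%:Z - 1).
have aE (c : 'F_p) : c != 0 -> c = (c ^ m) ^ u.
  move=> c0; have cp1 : c ^ (p%:Z - 1) = 1.
    apply: (mulIf c0); rewrite mul1r -[X in _ * X]expr1z -expfzDr// subrK.
    by have := expf_card c; rewrite card_Fp.
  rewrite exprz_exp -[LHS]expr1z -gm -uv expfzDr// [v * _]mulrC.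
  by rewrite -(exprz_exp _ (p%:Z - 1)) cp1 exp1rz mulr1 [u * _]mulrC.
have [a0|a0] := eqVneq a 0.
  move: ab; rewrite a0 exp0rz (negbTE m0) => /esym/eqP.
  by rewrite expfz_eq0 => /andP[_ /eqP].
have [b0|b0] := eqVneq b 0.
  move: ab; rewrite b0 exp0rz (negbTE m0) => /eqP.
  by rewrite expfz_eq0 => /andP[_ /eqP].
by rewrite (aE a)// ab -aE.
Qed.

Variable zeta : algC.
Hypothesis zeta_prim : p.-primitive_root zeta.
Definition Fp_char (a : 'F_p) : algC := zeta ^+ (a : nat).
Local Notation e := Fp_char.

Lemma Fp_char_nat m : e m%:R = zeta ^+ m.
Proof. by rewrite /e val_Fp_nat// prim_expr_mod. Qed.

Lemma Fp_charD : {morph e : a b / a + b >-> a * b}.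
Proof.
by move=> a b; rewrite -[a]natr_Zp -[b]natr_Zp -natrD !Fp_char_nat exprD.
Qed.

Lemma Fp_char0 : e 0 = 1. Proof. exact: expr0. Qed.

Lemma Fp_char_nontriv a : a != 0 -> e a != 1.
Proof.
move=> a0; rewrite /e -(prim_order_dvd zeta_prim) (dvdn_pcharf (pchar_Fp p_pr)).
by rewrite natr_Zp.
Qed.

(** As [t] is coprime to [p], some endomorphism of [algC] raises every [p]-th root of unity to the
    power [t]. *)
Lemma Fp_char_conj (t : 'F_p) : t != 0 ->
  exists u : {rmorphism algC -> algC}, forall a, u (e a) = e (t * a).
Proof.
move=> t0; have cop : coprime (t : nat) p.
  rewrite coprime_sym prime_coprime// (dvdn_pcharf (pchar_Fp p_pr)).
  by rewrite natr_Zp.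
have [u uE] := Qn_aut_exists cop; exists u => a; rewrite uE; last first.
  by rewrite /e exprAC (prim_expr_order zeta_prim) expr1n.
by rewrite -[t in RHS]natr_Zp -[a in RHS]natr_Zp -natrM Fp_char_nat mulnC exprM.
Qed.

Lemma sum_Fp_char (c : 'F_p) : \sum_t e (t * c) = if c == 0 then p%:R else 0.
Proof.
rewrite (sum_add_char Fp_charD Fp_char0) ?card_Fp//.
by exists 1; rewrite Fp_char_nontriv// oner_neq0.
Qed.

Definition gauss_period (t : 'F_p) : algC := \sum_(s in nzsquares) e (t * s).

(** Multiplication by [c ^+ 2] permutes the nonzero squares. *)
Lemma gauss_period_sqrM (c t : 'F_p) : c != 0 ->
  gauss_period (c ^+ 2 * t) = gauss_period t.
Proof.
move=> c0; rewrite /gauss_period [RHS](reindex_inj (mulfI (expf_neq0 2 c0))) /=.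
apply: eq_big => [s|s _]; first by rewrite nzsquaresM.
by rewrite mulrA (mulrC t).
Qed.

Lemma gauss_period0 : gauss_period 0 = #|nzsquares|%:R.
Proof.
rewrite /gauss_period -sumr_const; apply: eq_bigr => s _.
by rewrite mul0r Fp_char0.
Qed.

Lemma gauss_period_inversion i :
  \sum_t gauss_period (- t) * e (t * i) = p%:R * (i \in nzsquares)%:R.
Proof.
have nontriv : exists t, e t != 1 by exists 1; rewrite Fp_char_nontriv// oner_neq0.
have := fourier_inversion Fp_charD Fp_char0 nontriv nzsquares i.
rewrite card_Fp// => <-; rewrite (reindex_inj (@oppr_inj 'F_p)) /=.
by apply: eq_bigr => t _; rewrite opprK mulrN mulNr.
Qed.

End PrimeField.

(** * Twisted Walsh sums of a homogeneous function satisfying Condition A *)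

Section Bent.
Variables (p k : nat) (F : finFieldType) (zeta : algC).
Variables (f fstar : F -> 'F_p) (eps l : int).
Hypotheses (p_pr : prime p) (p_odd : odd p) (k_gt0 : (0 < k)%N).
Hypotheses (cF : #|F| = (p ^ (2 * k))%N) (zeta_prim : p.-primitive_root zeta).
Hypotheses (f0 : f 0 = 0) (fN : forall x, f (- x) = f x).
Hypothesis gcd_l : gcdz (l - 1) (p%:Z - 1) = 1.
Hypothesis f_homog : forall (a : 'F_p) (x : F), f (fpscale a x) = a ^ l * f x.
Hypothesis eps_sign : eps = 1 \/ eps = -1.
Hypothesis f_dual : forall b,
  walsh k zeta f b = eps%:~R * (p ^ k)%:R * zeta ^+ (nat_of_ord (fstar b)).

Local Notation e := (@Fp_char p zeta).
Local Notation tr := (@abs_tr p k F).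
Local Notation S := (nzsquares p).
Let chi (x : F) := e (tr x).
Let E : algC := eps%:~R * (p ^ k)%:R.

Let eD : {morph e : a b / a + b >-> a * b}.
Proof. exact: Fp_charD. Qed.

Let chiD : {morph chi : x y / x + y >-> x * y}.
Proof. by move=> x y; rewrite /chi (abs_trD p_pr) // eD. Qed.

Let chi0 : chi 0 = 1.
Proof. by rewrite /chi (abs_tr0 p_pr) // Fp_char0. Qed.

Let chi_nontriv : exists x, chi x != 1.
Proof.
by have [x trx] := abs_tr_nontriv p_pr k_gt0 cF; exists x; apply: Fp_char_nontriv.
Qed.

(** Apply to [f_dual] the conjugation sending [zeta] to its [t]-th power: it multiplies every
    exponent by [t] and fixes the integer [E]. *)
Lemma walsh_conj (t : 'F_p) b : t != 0 ->
  \sum_x e (t * (f x + tr (b * x))) = E * e (t * fstar b).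
Proof.
move=> t0; have [u uE] := Fp_char_conj p_pr zeta_prim t0.
have := congr1 u (f_dual b); rewrite /walsh rmorph_sum !rmorphM /= rmorph_int rmorph_nat.
by rewrite -/(Fp_char zeta (fstar b)) uE => <-; apply: eq_bigr => x _; rewrite -uE.
Qed.

(* gcd(l - 1, p - 1) = 1 forces l even, as p - 1 is even; so 1 - l is odd. *)
Lemma l_even : exists m : int, l = m * 2.
Proof.
have [r pE] : exists r, p = r.*2.+1 by exists p./2; rewrite -[LHS]odd_double_half p_odd.
apply/dvdzP; apply: contraTT (isT) => l_odd.
suff : (2 %| gcdz (l - 1) (p%:Z - 1))%Z by rewrite gcd_l.
rewrite dvdz_gcd; apply/andP; split; lia.
Qed.

(** The exponent is chosen so that homogeneity gives [phi t * f (fpscale t y) = t * f y] for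
    [t != 0]. *)
Let phi (t : 'F_p) : 'F_p := t ^ (1 - l).

Let phi_inj : injective phi.
Proof.
have [m lE] := l_even; apply: exprz_Fp_inj => //; first by lia.
by rewrite -opprB gcdNz.
Qed.

Let phi0 : phi 0 = 0.
Proof. by have [m lE] := l_even; rewrite /phi exp0rz; case: eqP => //; lia. Qed.

(** With [l = m * 2], [phi t] is [t] times the square of [t ^ (- m)], hence in the same square class
    as [t]. *)
Let gauss_period_phi t : gauss_period zeta (- phi t) = gauss_period zeta (- t).
Proof.
have [->|t0] := eqVneq t 0; first by rewrite phi0.
have [m lE] := l_even.
have -> : - phi t = (t ^ (- m)) ^+ 2 * - t.
  rewrite mulrN /phi addrC expfzDr// expr1z; congr (- (_ * _)).
  by rewrite -[RHS]/((t ^ (- m)) ^ 2%:Z) exprz_exp lE mulNr.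
by rewrite gauss_period_sqrM// expfz_neq0.
Qed.

(** Substituting [fpscale t y] for [x] pulls a common factor [t] out of both exponents, leaving a
    conjugated Walsh sum. *)
Lemma twisted_walsh (t : 'F_p) b : t != 0 ->
  \sum_x e (phi t * f x) * chi (b * x) = E * e (t * fstar b).
Proof.
move=> t0; rewrite -walsh_conj// (reindex_inj (mulfI (_ : (t : nat)%:R != 0 :> F))) /=.
  apply: eq_bigr => y _; rewrite /chi -eD f_homog mulrA mulrCA.
  by rewrite (abs_tr_scale p_pr)// -expfzDr// subrK expr1z mulrDr.
by rewrite (natr_Fp_eq0 p_pr cF).
Qed.

(** * The set where [f] is a nonzero square: its transform, size and difference counts *)

Definition square_values : {set F} := [set x | f x \in S].
Local Notation D := square_values.

Lemma square_valuesN x : (- x \in D) = (x \in D).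
Proof. by rewrite !inE fN. Qed.

Lemma square_values0 : 0 \notin D.
Proof. by rewrite !inE f0 eqxx. Qed.

Lemma fstar0 : fstar 0 = 0.
Proof.
apply/eqP; apply: contraTT (isT) => c0.
pose N := #|[set x | f x == 0]|.
have Nodd : odd N.
  rewrite odd_card_symmetric ?inE ?f0// => [|x]; last by rewrite !inE fN.
  exact: two_neq0_odd_pchar p_odd (card_finPcharP cF p_pr).
(* Zeros of [f] are counted by orthogonality: [t = 0] gives [p ^ (2 * k)], and the other [t] give
   [E] times the sum of [e (t * fstar 0)], which is -1 when [fstar 0 != 0]. *)
have : p%:R * N%:R = (p ^ (2 * k))%:R - E.
  transitivity (\sum_(t : 'F_p) \sum_x e (t * f x)).
    rewrite exchange_big /=; under [RHS]eq_bigr do rewrite sum_Fp_char//.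
    rewrite -big_mkcond sumr_const /= -[RHS]mulr_natr; congr (_ * _%:R).
    by apply: eq_card => x; rewrite inE.
  rewrite (bigD1 0)//= (eq_bigr (fun=> 1)) => [|x _]; last by rewrite mul0r Fp_char0.
  rewrite sumr_const cF; congr (_ + _).
  rewrite (eq_bigr (fun t => E * e (t * fstar 0))) => [|t t0].
    have := sum_Fp_char p_pr zeta_prim (fstar 0); rewrite (negbTE c0) (bigD1 0)//=.
    rewrite mul0r Fp_char0 addrC => /eqP; rewrite addr_eq0 -mulr_sumr => /eqP->.
    by rewrite mulrN1.
  rewrite -walsh_conj//; apply: eq_bigr => x _.
  by rewrite mul0r (abs_tr0 p_pr)// addr0.
move/eqP; rewrite /E -natrM -[(p * N)%:R]/((p * N)%N%:Z%:~R).
rewrite -[(p ^ (2 * k))%:R]/((p ^ (2 * k))%N%:Z%:~R).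
rewrite -[(p ^ k)%:R]/((p ^ k)%N%:Z%:~R) -intrM -intrB eqr_int => /eqP.
have : odd (p * N) by rewrite oddM p_odd.
have : odd (p ^ (2 * k)) by rewrite oddX p_odd orbT.
have : odd (p ^ k) by rewrite oddX p_odd orbT.
by case: eps_sign => ->; lia.
Qed.

Let hat b := \sum_(x in D) chi (b * x).

Lemma hatE b : p%:R * hat b =
  #|S|%:R * (p ^ (2 * k))%:R * (b == 0)%:R
  + E * (p%:R * (fstar b \in S)%:R - #|S|%:R).
Proof.
pose V t := \sum_x e (t * f x) * chi (b * x).
transitivity (\sum_t gauss_period zeta (- t) * V t).
  under [RHS]eq_bigr do rewrite mulr_sumr.
  rewrite exchange_big /= mulr_sumr big_mkcond; apply: eq_bigr => x _.
  under eq_bigr do rewrite mulrA.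
  rewrite -mulr_suml gauss_period_inversion// inE.
  by case: ifP => _; rewrite ?mulr1 ?mulr0 ?mul0r.
(* The term [t = 0] is [#|S|] times the sum of [chi (b * x)], nonzero only at [b = 0]; reindexing by
   [phi] makes all others twisted Walsh sums. *)
rewrite (reindex_inj phi_inj) (bigD1 0)//= phi0 oppr0 gauss_period0; congr (_ + _).
  rewrite -mulrA; congr (_ * _); rewrite /V.
  under eq_bigr do rewrite mul0r Fp_char0 mul1r mulrC.
  rewrite -cF; have := sum_add_char chiD chi0 chi_nontriv b.
  by move=> ->; case: eqP; rewrite ?mulr1 ?mulr0.
under eq_bigr => t t0 do rewrite gauss_period_phi /V twisted_walsh// mulrCA.
rewrite -mulr_sumr; congr (_ * _).
(* Second inversion, at [fstar b]; its missing term [t = 0] accounts for [- #|S|]. *)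
rewrite -(gauss_period_inversion p_pr zeta_prim) [in RHS](bigD1 0)//=.
by rewrite mul0r Fp_char0 oppr0 mulr1 gauss_period0 [RHS]addrC addKr.
Qed.

(** By [P_hp1], [h] is half of [P - p1], so the counts can be stated over the integers without
    division. *)
Let h : int := (#|S| * p ^ k.-1)%N.
Let p1 : int := (p ^ k.-1)%N.
Let P : int := (p ^ k)%N.

Let P_hp1 : P = h * 2 + p1.
Proof. by rewrite /P (expn_nzsquares p_pr p_odd k_gt0) PoszD PoszM. Qed.

Let pP : P = p%:Z * p1.
Proof. by rewrite /P -[in LHS](prednK k_gt0) expnS PoszM. Qed.

Let p_neq0 : p%:R != 0 :> algC.
Proof. by rewrite pnatr_eq0 -lt0n prime_gt0. Qed.

(** Here [E = p * eps * p1] and [p = 2 * #|S| + 1], so cancelling [p] in [hatE] leaves [eps * p1]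
    times [#|S| + 1] or [- #|S|], according to whether [fstar b] is in [S]. *)
Lemma hat_neq0 b : b != 0 ->
  hat b = (eps * (h + p1))%:~R \/ hat b = (- (eps * h))%:~R.
Proof.
move=> b0; have := hatE b; rewrite (negbTE b0) mulr0 add0r => H.
have EE : E = p%:R * (eps * p1)%:~R.
  by rewrite /E -[(p ^ k)%:R]/(P%:~R) -[p%:R]/(p%:Z%:~R) -!intrM pP; congr _%:~R; ring.
have hE : h = #|S|%:Z * p1 by rewrite /h PoszM.
have p2S : p%:Z = 2 * #|S|%:Z + 1.
  by have := card_nzsquares p_pr p_odd; have := prime_gt0 p_pr; lia.
move: H; rewrite EE -mulrA => /(mulfI p_neq0) ->.
rewrite -[p%:R]/(p%:Z%:~R) -[#|S|%:R]/(#|S|%:Z%:~R) hE p2S.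
case: (_ \in _); [left|right]; rewrite /= ?mulr1 ?mulr0 ?sub0r ?rmorphN/=.
  by rewrite -intrB -intrM; congr _%:~R; ring.
by rewrite mulrN -intrM; congr (- _%:~R); ring.
Qed.

(** This is [hatE] at [b = 0], where [fstar 0 = 0] lies outside [S]. *)
Lemma card_square_values : #|D|%:Z = h * (P - eps).
Proof.
have := hatE 0; rewrite /hat; under eq_bigr do rewrite mul0r chi0.
rewrite fstar0 !inE eqxx !mulr1 mulr0 sub0r sumr_const => H.
have hE : h = #|S|%:Z * p1 by rewrite /h PoszM.
apply/eqP; rewrite -(eqr_int algC); apply/eqP/(mulfI p_neq0).
rewrite [LHS]H /E -[(p ^ (2 * k))%:R]/((p ^ (2 * k))%N%:Z%:~R).
rewrite -[(p ^ k)%:R]/(P%:~R) -[p%:R]/(p%:Z%:~R) -[#|S|%:R]/(#|S|%:Z%:~R).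
have -> : (p ^ (2 * k))%N%:Z = P * P by rewrite mul2n -addnn expnD PoszM.
rewrite mulrN -!intrM -intrB; congr _%:~R.
by rewrite hE {2}pP {2}pP; ring.
Qed.

(** For the two values [r], [s] of [hat_neq0], [r + s = eps * p1], while [#|D| - r = P * (h - eps)]
    and [#|D| - s = P * h]; the factor [P * P = #|F|] then cancels. *)
Lemma square_values_count x : x != 0 ->
  #|[set gh in setX D D | gh.1 - gh.2 == x]|%:Z
  = eps * p1 * (x \in D)%:R + h * (h - eps).
Proof.
move=> x0.
have := two_valued_transform_count chiD chi0 chi_nontriv square_valuesN hat_neq0 x0.
set c := #|[set _ in _ | _]|; rewrite cF.
have -> : (p ^ (2 * k))%N = (p ^ k * p ^ k)%N by rewrite mul2n -addnn expnD.
have P0 : P != 0 by rewrite /P -lt0n expn_gt0 prime_gt0.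
rewrite -[c%:R]/(c%:Z%:~R) -[#|D|%:R]/(#|D|%:Z%:~R) -[(x \in D)%:R]/((x \in D)%:Z%:~R).
rewrite -[(_ * _)%:R]/((p ^ k * p ^ k)%N%:Z%:~R) PoszM -/P card_square_values.
rewrite -!(intrM, intrB, intrD) => /eqP; rewrite eqr_int => /eqP H.
apply: (mulfI (mulf_neq0 P0 P0)); rewrite {}H.
rewrite natz.
have -> : p1 = P - h * 2 by rewrite P_hp1 addrC addKr.
move: (Posz (x \in D)) (h) (P) eps => X h1 P1 eps1; ring.
Qed.

End Bent.

Theorem theorem2 (p k : nat) (F : finFieldType) (zeta : algC)
    (f : F -> 'F_p) (eps : int) :
  prime p -> odd p -> (0 < k)%N -> #|F| = (p ^ (2 * k))%N ->
  p.-primitive_root zeta ->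
  conditionA k zeta f eps ->
  let DS := [set x : F | (x != 0) && ((f x != 0) && [exists b : 'F_p, b ^+ 2 == f x])] in
  exists v d lam1 lam2 : nat,
    [/\ is_pds DS v d lam1 lam2 /\ is_srg (cayley DS) v d lam1 lam2,
        (v%:R : rat) = (p ^ (2 * k))%:R,
        (d%:R : rat) = 2^-1 * ((p ^ k)%:R - (p ^ k.-1)%:R) * ((p ^ k)%:R - eps%:~R),
        (lam1%:R : rat) = 4^-1 * ((p ^ k)%:R - (p ^ k.-1)%:R) ^+ 2
                          - 3%:R / 2%:R * eps%:~R * ((p ^ k)%:R - (p ^ k.-1)%:R)
                          + eps%:~R * (p ^ k)%:R &
        (lam2%:R : rat) = 2^-1 * ((p ^ k)%:R - (p ^ k.-1)%:R)
                          * (2^-1 * ((p ^ k)%:R - (p ^ k.-1)%:R) - eps%:~R)].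
Proof.
move=> p_pr p_odd k_gt0 cF zeta_prim [f0 fN [l [gcd_l f_homog]] eps_sign [fstar f_dual]] DS.
have DSE : DS = square_values f.
  apply/setP => x; rewrite !inE andb_idl// => /andP[fx _].
  by apply: contraNneq fx => ->; rewrite f0.
have DN := square_valuesN fN.
have cD :=
  card_square_values p_pr p_odd k_gt0 cF zeta_prim f0 fN gcd_l f_homog eps_sign f_dual.
have count :=
  square_values_count p_pr p_odd k_gt0 cF zeta_prim f0 fN gcd_l f_homog eps_sign f_dual.
have PE : (p ^ k)%N%:Z = (#|nzsquares p| * p ^ k.-1)%N%:Z * 2 + (p ^ k.-1)%N%:Z.
  by rewrite {1}(expn_nzsquares p_pr p_odd k_gt0) PoszD PoszM.
have p1_gt0 : 0 < (p ^ k.-1)%N%:Z by rewrite ltz_nat expn_gt0 prime_gt0.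
(* The odd prime [p] exceeds 1, so there is at least one nonzero square. *)
have h_ge : (p ^ k.-1)%N%:Z <= (#|nzsquares p| * p ^ k.-1)%N%:Z.
  rewrite lez_nat leq_pmull// lt0n; apply: contraTneq (prime_gt1 p_pr) => S0.
  have := card_nzsquares p_pr p_odd; rewrite S0 muln0.
  by case: (p) p_odd => [|[]].
set h := (_ * _)%N%:Z in cD count PE h_ge.
set P := (p ^ k)%N%:Z in cD PE.
set p1 := (p ^ k.-1)%N%:Z in count PE h_ge p1_gt0.
(* From [h >= p1 >= 1] both counts are nonnegative for either sign, so [absz] below preserves
   them. *)
have lam2_ge0 : 0 <= h * (h - eps) by case: eps_sign => ->; nia.
have lam1_ge0 : 0 <= eps * p1 + h * (h - eps) by case: eps_sign => ->; nia.
have pds : is_pds DS (p ^ (2 * k)) #|DS|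
    (absz (eps * p1 + h * (h - eps))) (absz (h * (h - eps))).
  split=> //; first by rewrite DSE square_values0.
  move=> x x0; apply/eqP; rewrite -eqz_nat DSE count//.
  by case: ifP => _; rewrite gez0_abs// ?mulr1 ?mulr0 ?add0r.
exists (p ^ (2 * k))%N, #|DS|, (absz (eps * p1 + h * (h - eps))), (absz (h * (h - eps))).
have natE (n : nat) : n%:R = n%:Z%:~R :> rat by [].
(* Writing [p ^ k] as [2 * h + p1] turns each rational formula into a field identity in [h], [p1]
   and [eps]. *)
have PR : (p ^ k)%:R = h%:~R * 2 + p1%:~R :> rat.
  by rewrite natE -/P PE rmorphD rmorphM.
split=> //.
- by split=> //; apply: is_pds_srg pds => x; rewrite DSE DN.
- by rewrite natE DSE cD PR natE -/p1 PE !(rmorphM, rmorphB, rmorphD) /=; field.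
- rewrite natE gez0_abs// PR natE -/p1 !(rmorphM, rmorphB, rmorphD) /=.
  by field.
by rewrite natE gez0_abs// PR natE -/p1 !(rmorphM, rmorphB, rmorphD) /=; field.
Qed.
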